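(* Let $\mathcal{G}$ be a finite connected groupoid and let $\mathcal{H}$ be a subgroupoid of $\mathcal{G}$ with connected components $\mathcal{H}_1,\dots,\mathcal{H}_n$. For $1\le i\le n$ let $e_i\in(\mathcal{H}_i)_0$ and let $\mathcal{H}_{e_i}$ be the isotropy group of $\mathcal{H}_i$ at $e_i$. Let $e\in\mathcal{G}_0$. Then $$(\mathcal{G}:\mathcal{H})=|\mathcal{H}_0|\left(\sum_{i=1}^{n}(\mathcal{G}_e:\mathcal{H}_{e_i})\right).$$
   Context: A groupoid is a nonempty set $\mathcal{G}$ with a partially defined associative operation in which every $g$ has an inverse $g^{-1}$, a right identity $d(g)=g^{-1}g$ (domain) and a left identity $r(g)=gg^{-1}$ (range); the product $gh$ exists if and only if $d(g)=r(h)$. $\mathcal{G}_0$ is the set of identities and $\mathcal{G}_e=\{g:d(g)=r(g)=e\}$ is the isotropy group at $e\in\mathcal{G}_0$. A subgroupoid is a nonempty subset that is a groupoid under the restricted operation. A groupoid is connected if for any identities $e,f$ there is $g$ with $d(g)=e$, $r(g)=f$; every groupoid is the disjoint union of its connected components. For $g\in\mathcal{G}$ the right coset is $\mathcal{H}g=\{hg:h\in\mathcal{H},\ d(h)=r(g)\}$ and the left coset is $g\mathcal{H}=\{gh:h\in\mathcal{H},\ r(h)=d(g)\}$. The coset of $g$ in $\mathcal{H}$ is called empty if $\mathcal{H}g=\emptyset$ or $g\mathcal{H}=\emptyset$, i.e. if $r(g)\notin\mathcal{H}_0$ or $d(g)\notin\mathcal{H}_0$. The index $(\mathcal{G}:\mathcal{H})$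 is the number of non-empty cosets of $\mathcal{H}$ in $\mathcal{G}$, i.e. the number of distinct sets $\mathcal{H}g$ with $g\in\mathcal{G}$, $r(g)\in\mathcal{H}_0$ and $d(g)\in\mathcal{H}_0$. Since $\mathcal{G}$ is connected all its isotropy groups are isomorphic; $(\mathcal{G}_e:\mathcal{H}_{e_i})$ denotes $|\mathcal{G}_e|/|\mathcal{H}_{e_i}|$, equal to the index of the subgroup $\mathcal{H}_{e_i}$ in $\mathcal{G}_{e_i}$. *)

(* Defs.v *)
From mathcomp Require Import all_boot all_order all_algebra.

Set Implicit Arguments.
Unset Strict Implicit.
Unset Printing Implicit Defensive.

Import GRing.Theory.
Local Open Scope ring_scope.

(* The subset A is a groupoid under the partial operation mul, where
   mul g h = None means that the product gh does not exist.
   Associativity is an equality of options: (gh)k exists if and only if g(hk)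
   does, and then they are equal.  The identities dom g and rng g lie in A by
   the closure axioms. *)
Record groupoid_on (T : finType) (A : {set T})
    (mul : T -> T -> option T) (inv dom rng : T -> T) : Prop := GroupoidOn {
  groupoid_neq0 : A != set0;
  groupoid_mulP : {in A &, forall g h x, mul g h = Some x -> x \in A};
  groupoid_invP : {in A, forall g, inv g \in A};
  groupoid_mulA : {in A & &, forall g h k,
    obind (fun gh => mul gh k) (mul g h) = obind (mul g) (mul h k)};
  groupoid_mulVg : {in A, forall g, mul (inv g) g = Some (dom g)};
  groupoid_mulgV : {in A, forall g, mul g (inv g) = Some (rng g)};
  groupoid_mulgd : {in A, forall g, mul g (dom g) = Some g};
  groupoid_mulrg : {in A, forall g, mul (rng g) g = Some g};
  groupoid_mul_exists : {in A &, forall g h, mul g h <-> dom g = rng h}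
}.

Record finGroupoid (T : finType) := FinGroupoid {
  gmul : T -> T -> option T;
  ginv : T -> T;
  gdom : T -> T;
  grng : T -> T;
  finGroupoidP : groupoid_on [set: T] gmul ginv gdom grng
}.

Section Defs.
Variables (T : finType) (G : finGroupoid T).
Implicit Types (A C H : {set T}) (e g : T).

(* The inverses and identities witnessing that H is a groupoid are not required
   to be those of G; they coincide with them on H by uniqueness. *)
Definition subgroupoid H : Prop :=
  exists inv dom rng : T -> T, groupoid_on H (gmul G) inv dom rng.

Definition identities A : {set T} :=
  [set gdom G g | g in A] :|: [set grng G g | g in A].

Definition isotropy A e : {set T} :=
  [set g in A | (gdom G g == e) && (grng G g == e)].

Definition gconnected A : Prop :=
  {in identities A &, forall e f,
    exists2 g, g \in A & gdom G g = e /\ grng G g = f}.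

(* Connected components are the maximal connected subgroupoids. *)
Definition connected_component H C : Prop :=
  [/\ subgroupoid C, gconnected C, C \subset H &
      forall D : {set T}, subgroupoid D -> gconnected D -> D \subset H ->
        C \subset D -> D = C].

Definition right_coset H g : {set T} :=
  [set x | [exists h in H, (gdom G h == grng G g) && (gmul G h g == Some x)]].

Definition left_coset g H : {set T} :=
  [set x | [exists h in H, (grng G h == gdom G g) && (gmul G g h == Some x)]].

Definition empty_coset H g : bool :=
  (right_coset H g == set0) || (left_coset g H == set0).

Definition groupoid_index H : nat :=
  #|[set right_coset H g | g in [set g | ~~ empty_coset H g]]|.

(* The quotient is taken in rat, so that no divisibility is presupposed. *)
Definition isotropy_index A e C f : rat :=
  #|isotropy A e|%:R / #|isotropy C f|%:R.

End Defs.

(* Main.v *)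
Require Import Defs.
From mathcomp Require Import all_boot all_order all_algebra.

(** The index counts the classes of the relation [H x = H g] on the set of
    those [g] whose domain and range are both identities of [H].  A number of
    classes is the sum, over all elements, of the inverse of the size of the
    class of the element ([card_imset_sumV]).  Here the class of [g] is the
    coset [H g] itself, and right cancellation puts it in bijection with the
    star of [H] at [r(g)], the set of [h] in [H] with [d(h) = r(g)].  Hence

      (G : H) = \sum_(a, b in H_0) \sum_(g : a -> b) 1 / |star_H(b)|.

    In a connected groupoid all the sets of arrows from one identity to another
    have the size of the isotropy groups ([card_arrows]).  Applied to [G], this
    turns the right-hand side into |H_0| |G_e| \sum_(b in H_0) 1 / |star_H(b)|.
    Applied to the component [C] of [H] containing [b], in which the whole star
    at [b] lies, it gives |star_H(b)| = |C_0| |C_f| for any identity [f] of [C].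
    The identities of [H] are partitioned by the components, and the |C_0|
    identities of [C] together contribute 1 / |C_f|, which yields the formula.

    The components of [H], defined by maximality, are identified with the
    explicit sets [reachable H f] of the elements of [H] whose domain is joined
    to the identity [f] by an element of [H]. *)

Set Implicit Arguments.
Unset Strict Implicit.
Unset Printing Implicit Defensive.

Import GRing.Theory Num.Theory.
Local Open Scope ring_scope.

(** * Counting the values of a function *)

(** The elements of each fibre receive equal shares, adding up to 1. *)
Lemma card_imset_sumV (I J : finType) (F : I -> J) (A : {set I}) :
  #|F @: A|%:R = \sum_(x in A) #|[set y in A | F y == F x]|%:R^-1 :> rat.
Proof.
rewrite (partition_big_imset F) /= -sum1_card natr_sum.
apply: eq_bigr => z /imsetP[x xA ->].
rewrite (eq_bigr (fun=> #|[set y in A | F y == F x]|%:R^-1)); last first.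
  by move=> y /andP[_ /eqP->].
rewrite (eq_bigl (fun y => y \in [set y in A | F y == F x])); last first.
  by move=> y; rewrite inE.
rewrite sumr_const -[RHS]mulr_natl divff // pnatr_eq0 -lt0n card_gt0.
by apply/set0Pn; exists x; rewrite inE xA eqxx.
Qed.

Section GroupoidTheory.
Variables (T : finType) (G : finGroupoid T).
Implicit Types (A B C H : {set T}) (a b e f g h k l x y : T).

Local Notation d := (gdom G).
Local Notation r := (grng G).
Local Notation V := (ginv G).

(** * Calculus in a groupoid *)

(** A total extension of the product, so that products can be composed and
    rewritten; outside composable pairs its value is arbitrary. *)
Definition gprod g h : T := odflt g (gmul G g h).

Local Infix "**" := gprod (at level 40, left associativity).

Lemma gmul_gprod g h : d g = r h -> gmul G g h = Some (g ** h).
Proof.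
move/(groupoid_mul_exists (finGroupoidP G) (in_setT g) (in_setT h)).
by rewrite /gprod; case: (gmul G g h).
Qed.

Lemma gmul_SomeP g h x : gmul G g h = Some x -> d g = r h /\ g ** h = x.
Proof.
move=> E; rewrite /gprod E; split=> //.
by apply/(groupoid_mul_exists (finGroupoidP G) (in_setT g) (in_setT h)); rewrite E.
Qed.

Lemma gprodd g : g ** d g = g.
Proof. by case: (gmul_SomeP (groupoid_mulgd (finGroupoidP G) (in_setT g))). Qed.

Lemma rgprod g : r g ** g = g.
Proof. by case: (gmul_SomeP (groupoid_mulrg (finGroupoidP G) (in_setT g))). Qed.

Lemma gprodVg g : V g ** g = d g.
Proof. by case: (gmul_SomeP (groupoid_mulVg (finGroupoidP G) (in_setT g))). Qed.

Lemma gprodgV g : g ** V g = r g.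
Proof. by case: (gmul_SomeP (groupoid_mulgV (finGroupoidP G) (in_setT g))). Qed.

Lemma dom_inv g : d (V g) = r g.
Proof. by case: (gmul_SomeP (groupoid_mulVg (finGroupoidP G) (in_setT g))). Qed.

Lemma rng_inv g : r (V g) = d g.
Proof. by case: (gmul_SomeP (groupoid_mulgV (finGroupoidP G) (in_setT g))). Qed.

Lemma rng_dom g : r (d g) = d g.
Proof. by case: (gmul_SomeP (groupoid_mulgd (finGroupoidP G) (in_setT g))). Qed.

Lemma dom_rng g : d (r g) = r g.
Proof. by case: (gmul_SomeP (groupoid_mulrg (finGroupoidP G) (in_setT g))). Qed.

Lemma dom_dom g : d (d g) = d g.
Proof. by rewrite -{1}[d g]rng_dom dom_rng rng_dom. Qed.

(** Since g(h d(h)) exists, associativity makes (gh) d(h) exist as well. *)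
Lemma dom_gprod g h : d g = r h -> d (g ** h) = d h.
Proof.
move=> gh.
have := groupoid_mulA (finGroupoidP G) (in_setT g) (in_setT h) (in_setT (d h)).
rewrite (groupoid_mulgd (finGroupoidP G) (in_setT h)) /= gmul_gprod //=.
by case/gmul_SomeP => ->; rewrite rng_dom.
Qed.

Lemma rng_gprod g h : d g = r h -> r (g ** h) = r g.
Proof.
move=> gh.
have := groupoid_mulA (finGroupoidP G) (in_setT (r g)) (in_setT g) (in_setT h).
rewrite (groupoid_mulrg (finGroupoidP G) (in_setT g)) /= gmul_gprod //=.
by case/esym/gmul_SomeP => <-; rewrite dom_rng.
Qed.

Lemma gprodA g h k : d g = r h -> d h = r k -> g ** h ** k = g ** (h ** k).
Proof.
move=> gh hk.
have := groupoid_mulA (finGroupoidP G) (in_setT g) (in_setT h) (in_setT k).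
rewrite !gmul_gprod //= !gmul_gprod ?dom_gprod ?rng_gprod //.
by case.
Qed.

Lemma gprodKV g h : d g = r h -> V g ** (g ** h) = h.
Proof. by move=> gh; rewrite -gprodA ?dom_inv // gprodVg gh rgprod. Qed.

Lemma gprodK g h : d g = r h -> g ** h ** V h = g.
Proof. by move=> gh; rewrite gprodA ?rng_inv // gprodgV -gh gprodd. Qed.

(** * Subgroupoids *)

(** Cancellation in [G] shows that the identities and inverses of a subgroupoid
    are those of [G]. *)
Lemma subgroupoid_inv H g : subgroupoid G H -> g \in H -> V g \in H.
Proof.
case=> inv [dom [rng GH]] gH.
have iH := groupoid_invP GH gH.
have [ig igE] := gmul_SomeP (groupoid_mulVg GH gH).
have [gd gdE] := gmul_SomeP (groupoid_mulgd GH gH).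
have domE : dom g = d g by rewrite -(gprodKV gd) gdE gprodVg.
suff -> : V g = inv g by [].
by rewrite -(gprodK ig) igE domE -(rng_inv g) rgprod.
Qed.

Lemma subgroupoid_gprod H g h : subgroupoid G H ->
  g \in H -> h \in H -> d g = r h -> g ** h \in H.
Proof.
case=> inv [dom [rng GH]] gH hH gh.
exact: (groupoid_mulP GH gH hH (gmul_gprod gh)).
Qed.

Lemma subgroupoid_dom H g : subgroupoid G H -> g \in H -> d g \in H.
Proof.
move=> sH gH; rewrite -gprodVg.
by apply: subgroupoid_gprod; rewrite ?dom_inv // subgroupoid_inv.
Qed.

Lemma subgroupoid_rng H g : subgroupoid G H -> g \in H -> r g \in H.
Proof. by move=> sH gH; rewrite -dom_inv subgroupoid_dom // subgroupoid_inv. Qed.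

Lemma subgroupoid_closed H : H != set0 ->
  {in H, forall g, V g \in H} ->
  {in H &, forall g h, d g = r h -> g ** h \in H} -> subgroupoid G H.
Proof.
move=> H0 HV HM; exists V, d, r; have GP := finGroupoidP G; split=> //.
- by move=> g h gH hH x /gmul_SomeP[gh <-]; apply: HM.
- by move=> g h k *; apply: (groupoid_mulA GP).
- by move=> g _; apply: (groupoid_mulVg GP).
- by move=> g _; apply: (groupoid_mulgV GP).
- by move=> g _; apply: (groupoid_mulgd GP).
- by move=> g _; apply: (groupoid_mulrg GP).
- by move=> g h _ _; apply: (groupoid_mul_exists GP).
Qed.

Lemma subgroupoidT : subgroupoid G [set: T].
Proof. by exists V, d, r; apply: finGroupoidP. Qed.

Lemma dom_identities H g : g \in H -> d g \in identities G H.
Proof. by move=> gH; rewrite inE imset_f. Qed.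

Lemma rng_identities H g : g \in H -> r g \in identities G H.
Proof. by move=> gH; rewrite inE orbC imset_f. Qed.

Lemma identitiesP H f : subgroupoid G H ->
  reflect (f \in H /\ d f = f) (f \in identities G H).
Proof.
move=> sH; apply: (iffP idP) => [|[fH <-]]; last exact: dom_identities.
rewrite inE => /orP[] /imsetP[g gH ->].
  by rewrite dom_dom subgroupoid_dom.
by rewrite dom_rng subgroupoid_rng.
Qed.

Lemma identity_rng H f : subgroupoid G H -> f \in identities G H -> r f = f.
Proof. by move=> sH /identitiesP[]// _ <-; rewrite rng_dom. Qed.

(** * Arrows between two identities *)

Definition arrows A a b : {set T} := [set g in A | (d g == a) && (r g == b)].

Lemma arrowsP A a b g :
  reflect [/\ g \in A, d g = a & r g = b] (g \in arrows A a b).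
Proof.
rewrite inE; apply: (iffP and3P) => [[gA /eqP da /eqP rb]|[gA -> ->]] //.
Qed.

(** Conjugation g |-> k g l^-1 is injective. *)
Lemma leq_arrows A a b a' b' k l : subgroupoid G A ->
  l \in arrows A a a' -> k \in arrows A b b' ->
  (#|arrows A a b| <= #|arrows A a' b'|)%N.
Proof.
move=> sA /arrowsP[lA dl rl] /arrowsP[kA dk rk].
have inj : {in arrows A a b &, injective (fun g => k ** g ** V l)}.
  move=> g h /arrowsP[_ dg rg] /arrowsP[_ dh rh] /(congr1 (gprod^~ (V (V l)))).
  rewrite !gprodK ?rng_inv ?dom_gprod ?dk ?dl //.
  by move/(congr1 (gprod (V k))); rewrite !gprodKV ?dk.
rewrite -(card_in_imset inj); apply/subset_leq_card/subsetP => _ /imsetP[g + ->].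
move=> /arrowsP[gA dg rg]; have kg : d k = r g by rewrite dk.
have gl : d (k ** g) = r (V l) by rewrite dom_gprod // rng_inv dl.
apply/arrowsP; split; last by rewrite !rng_gprod.
  by rewrite !subgroupoid_gprod // subgroupoid_inv.
by rewrite dom_gprod // dom_inv.
Qed.

Lemma arrows_inv A a b g : subgroupoid G A ->
  g \in arrows A a b -> V g \in arrows A b a.
Proof.
move=> sA /arrowsP[gA da rb].
by apply/arrowsP; rewrite subgroupoid_inv // dom_inv rng_inv.
Qed.

(** Connectedness provides arrows from [a] and [b] to [e]; conjugating by them,
    and by their inverses, bounds each cardinal by the other. *)
Lemma card_arrows A a b e : subgroupoid G A -> gconnected G A ->
  a \in identities G A -> b \in identities G A -> e \in identities G A ->
  #|arrows A a b| = #|isotropy G A e|.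
Proof.
move=> sA cA aA bA eA; have arr a' : a' \in identities G A ->
    exists k, k \in arrows A a' e.
  by move=> a'A; have [k kA [dk rk]] := cA _ _ a'A eA; exists k; apply/arrowsP.
have [[k ka] [l lb]] := (arr a aA, arr b bA).
apply/eqP; rewrite eqn_leq -[isotropy _ _ _]/(arrows A e e).
by rewrite (leq_arrows sA ka lb) (leq_arrows sA (arrows_inv sA ka) (arrows_inv sA lb)).
Qed.

Definition star A f : {set T} := [set g in A | d g == f].

(** The range map splits the star into the sets of arrows from [f]. *)
Lemma card_star_connected A f e : subgroupoid G A -> gconnected G A ->
  f \in identities G A -> e \in identities G A ->
  #|star A f| = (#|identities G A| * #|isotropy G A e|)%N.
Proof.
move=> sA cA fA eA; rewrite -sum1_card.
rewrite (partition_big r (mem (identities G A))) /=; last first.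
  by move=> g; rewrite inE => /andP[gA _]; apply: rng_identities.
rewrite -sum_nat_const; apply: eq_bigr => b bA.
rewrite -(card_arrows sA cA fA bA eA) -sum1_card.
by apply: eq_bigl => g; rewrite !inE andbA.
Qed.

(** * Connected components *)

Definition reachable H f : {set T} :=
  [set h in H | [exists k, k \in arrows H f (d h)]].

Lemma reachableP H f h :
  reflect (h \in H /\ exists k, k \in arrows H f (d h)) (h \in reachable H f).
Proof.
by rewrite inE; apply: (iffP andP) => -[hH] /existsP.
Qed.

Lemma identity_reachable H f : subgroupoid G H -> f \in identities G H ->
  f \in reachable H f.
Proof.
move=> sH fH; have [ffH df] := identitiesP f sH fH.
apply/reachableP; split=> //; exists f; apply/arrowsP.
by rewrite df (identity_rng sH fH).
Qed.

Lemma arrows_comp H a b c g h : subgroupoid G H ->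
  g \in arrows H b c -> h \in arrows H a b -> g ** h \in arrows H a c.
Proof.
move=> sH /arrowsP[gH dg rg] /arrowsP[hH dh rh].
have gh : d g = r h by rewrite dg.
by apply/arrowsP; rewrite subgroupoid_gprod // dom_gprod // rng_gprod.
Qed.

Lemma subgroupoid_reachable H f : subgroupoid G H -> f \in identities G H ->
  subgroupoid G (reachable H f).
Proof.
move=> sH fH; apply: subgroupoid_closed.
- by apply/set0Pn; exists f; apply: identity_reachable.
- move=> h /reachableP[hH [k kf]]; apply/reachableP; rewrite subgroupoid_inv //.
  split=> //; exists (h ** k); rewrite dom_inv.
  by apply: arrows_comp kf => //; apply/arrowsP.
- move=> g h /reachableP[gH _] /reachableP[hH [k kf]] gh; apply/reachableP.
  by rewrite subgroupoid_gprod // dom_gprod //; split=> //; exists k.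
Qed.

Lemma gconnected_reachable H f : subgroupoid G H -> f \in identities G H ->
  gconnected G (reachable H f).
Proof.
move=> sH fH a b; have sR := subgroupoid_reachable sH fH.
case/(identitiesP _ sR) => /reachableP[aH [k]] + da.
move=> + /(identitiesP _ sR)[/reachableP[bH [l]]] + db.
rewrite da db => ka lb.
have /arrowsP[gH dg rg] := arrows_comp sH lb (arrows_inv sH ka).
exists (l ** V k) => //; apply/reachableP; split=> //.
by exists k; rewrite dg.
Qed.

(** Connectedness joins [f] to the domain of every element of [C].  Thus
    [reachable H f] is the largest connected subgroupoid of [H] having the
    identity [f]. *)
Lemma sub_reachable H C f : subgroupoid G C -> gconnected G C -> C \subset H ->
  f \in identities G C -> C \subset reachable H f.
Proof.
move=> sC cC /subsetP CH fC; apply/subsetP => x xC; apply/reachableP.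
split; first exact: CH.
have [k kC [dk rk]] := cC _ _ fC (dom_identities xC).
by exists k; apply/arrowsP; rewrite CH.
Qed.

Lemma reachable_sub H f : reachable H f \subset H.
Proof. by apply/subsetP => x /reachableP[]. Qed.

Lemma identitiesS A B : A \subset B -> identities G A \subset identities G B.
Proof. by move=> AB; rewrite setUSS // imsetS. Qed.

Lemma reachable_identities H f : subgroupoid G H -> f \in identities G H ->
  f \in identities G (reachable H f).
Proof.
move=> sH fH; have [_ df] := identitiesP f sH fH.
by rewrite -{1}df dom_identities // identity_reachable.
Qed.

Lemma connected_component_reachable H f : subgroupoid G H ->
  f \in identities G H -> connected_component G H (reachable H f).
Proof.
move=> sH fH; split; [exact: subgroupoid_reachable | exact: gconnected_reachable
  | exact: reachable_sub | move=> D sD cD DH RD].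
apply/eqP; rewrite eqEsubset RD andbT sub_reachable //.
by rewrite (subsetP (identitiesS RD)) // reachable_identities.
Qed.

(** A component is determined by any one of its identities, so distinct
    components share none. *)
Lemma connected_componentE H C f : subgroupoid G H ->
  connected_component G H C -> f \in identities G C -> C = reachable H f.
Proof.
move=> sH [sC cC CH maxC] fC.
have fH : f \in identities G H by rewrite (subsetP (identitiesS CH)).
apply/esym/maxC; last exact: sub_reachable.
- exact: subgroupoid_reachable.
- exact: gconnected_reachable.
- exact: reachable_sub.
Qed.

Lemma star_reachable H f : subgroupoid G H -> f \in identities G H ->
  star (reachable H f) f = star H f.
Proof.
move=> sH fH; apply/setP => h; rewrite !inE -andbA; apply: andb_id2l => hH.
apply: andb_idl => /eqP ->; apply/existsP; exists f; apply/arrowsP.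
by have [ffH df] := identitiesP f sH fH; rewrite (identity_rng sH fH).
Qed.

Lemma card_star_component H C f e : subgroupoid G H ->
  connected_component G H C -> f \in identities G C -> e \in identities G C ->
  #|star H f| = (#|identities G C| * #|isotropy G C e|)%N.
Proof.
move=> sH cC fC eC; have [sC gC CH _] := cC.
rewrite -(card_star_connected sC gC fC eC) (connected_componentE sH cC fC).
by rewrite star_reachable // (subsetP (identitiesS CH)).
Qed.

(** * Cosets *)

Lemma right_cosetP H g x :
  reflect (exists h, [/\ h \in H, d h = r g & x = h ** g])
          (x \in right_coset G H g).
Proof.
rewrite inE; apply: (iffP exists_inP) => [[h hH /andP[/eqP hg /eqP E]]|].
  by exists h; split=> //; case: (gmul_SomeP E).
by case=> h [hH hg ->]; exists h; rewrite // hg eqxx gmul_gprod //=.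
Qed.

Lemma right_coset_imset H g :
  right_coset G H g = [set h ** g | h in star H (r g)].
Proof.
apply/setP => x; apply/right_cosetP/imsetP => [[h [hH hg ->]]|[h + ->]].
  by exists h; rewrite // inE hH hg eqxx.
by rewrite inE => /andP[hH /eqP hg]; exists h.
Qed.

Lemma card_right_coset H g : #|right_coset G H g| = #|star H (r g)|.
Proof.
rewrite right_coset_imset card_in_imset // => h k.
rewrite !inE => /andP[_ /eqP hg] /andP[_ /eqP kg] /(congr1 (gprod^~ (V g))).
by rewrite !gprodK.
Qed.

Lemma sub_right_coset H g x : subgroupoid G H -> x \in right_coset G H g ->
  right_coset G H x \subset right_coset G H g.
Proof.
move=> sH /right_cosetP[h [hH hg ->]]; apply/subsetP => y.
case/right_cosetP => k [kH]; rewrite rng_gprod // => kh ->.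
apply/right_cosetP; exists (k ** h).
by rewrite subgroupoid_gprod // dom_gprod // gprodA.
Qed.

Lemma right_coset_sym H g x : subgroupoid G H ->
  x \in right_coset G H g -> g \in right_coset G H x.
Proof.
move=> sH /right_cosetP[h [hH hg ->]]; apply/right_cosetP; exists (V h).
by rewrite subgroupoid_inv // dom_inv rng_gprod // gprodKV.
Qed.

Lemma right_coset_refl H g : subgroupoid G H -> r g \in identities G H ->
  g \in right_coset G H g.
Proof.
move=> sH /(identitiesP _ sH)[rH dr]; apply/right_cosetP; exists (r g).
by rewrite dr rgprod.
Qed.

(** The cosets are the classes of an equivalence relation on the elements with
    range in [H_0], so that the fibre of [g |-> H g] through [g] is [H g]. *)
Lemma eq_right_coset H g x : subgroupoid G H -> r x \in identities G H ->
  (right_coset G H x == right_coset G H g) = (x \in right_coset G H g).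
Proof.
move=> sH xH; apply/eqP/idP => [<-|xg]; first exact: right_coset_refl.
by apply/eqP; rewrite eqEsubset !sub_right_coset // right_coset_sym.
Qed.

(** When they are in [H], the identities [d g] and [r g] witness that the left
    and the right coset contain [g]. *)
Lemma nonempty_cosetE H g : subgroupoid G H ->
  ~~ empty_coset G H g = (d g \in identities G H) && (r g \in identities G H).
Proof.
move=> sH; rewrite negb_or andbC; congr (_ && _).
  apply/set0Pn/idP => [[x]|dH].
    by rewrite inE => /exists_inP[h hH /andP[/eqP <- _]]; apply: rng_identities.
  have [dgH _] := identitiesP _ sH dH; exists g; rewrite inE.
  apply/exists_inP; exists (d g) => //.
  by rewrite rng_dom eqxx gmul_gprod ?rng_dom // gprodd /=.
apply/set0Pn/idP => [[x /right_cosetP[h [hH <- _]]]|rH].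
  exact: dom_identities.
by exists g; apply: right_coset_refl.
Qed.

Lemma groupoid_index_sumV H : subgroupoid G H ->
  (groupoid_index G H)%:R =
  \sum_(g | (d g \in identities G H) && (r g \in identities G H))
    #|star H (r g)|%:R^-1 :> rat.
Proof.
move=> sH; rewrite /groupoid_index card_imset_sumV.
apply: eq_big => [g|g]; rewrite inE nonempty_cosetE // => /andP[dg rg].
congr (_%:R^-1); rewrite -card_right_coset; apply: eq_card => x.
rewrite inE inE nonempty_cosetE //; apply/andP/idP => [[/andP[_ rx]]|xg].
  by rewrite eq_right_coset.
have [h [hH hg xE]] := right_cosetP _ _ _ xg.
have rx : r x \in identities G H by rewrite xE rng_gprod // rng_identities.
by rewrite eq_right_coset // rx xE dom_gprod // dg -xE.
Qed.

Lemma groupoid_index_connected H e : gconnected G [set: T] ->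
  subgroupoid G H -> e \in identities G [set: T] ->
  (groupoid_index G H)%:R =
  #|identities G H|%:R *
    \sum_(f in identities G H) #|isotropy G [set: T] e|%:R / #|star H f|%:R :> rat.
Proof.
move=> cG sH eG; rewrite groupoid_index_sumV //.
rewrite (partition_big d (mem (identities G H))) /=; last by move=> g /andP[].
rewrite mulr_natl -sumr_const; apply: eq_bigr => a aH.
rewrite (partition_big r (mem (identities G H))) /=; last first.
  by move=> g /andP[/andP[]].
apply: eq_bigr => b bH.
have inG f : f \in identities G H -> f \in identities G [set: T].
  by apply: subsetP; rewrite identitiesS // subsetT.
rewrite -(card_arrows subgroupoidT cG (inG a aH) (inG b bH) eG).
rewrite mulr_natl -sumr_const; apply: eq_big => [g|g /andP[_ /eqP->]] //.
apply/idP/arrowsP => [/andP[/andP[_ /eqP->] /eqP->] // | [_ -> ->]].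
by rewrite aH bH !eqxx.
Qed.

(** * Summing over the components *)

(** An identity [f] of [H] lies in exactly one component, [reachable H f]. *)
Lemma sum_identities_components H n (Hc : 'I_n -> {set T}) (F : T -> rat) :
  subgroupoid G H -> injective Hc ->
  (forall C, connected_component G H C <-> exists i, C = Hc i) ->
  \sum_(f in identities G H) F f =
  \sum_(i < n) \sum_(f in identities G (Hc i)) F f.
Proof.
move=> sH Hc_inj HcP.
have cHc i : connected_component G H (Hc i) by apply/HcP; exists i.
rewrite [RHS](exchange_big_dep (mem (identities G H))) /=; last first.
  by move=> i f _; apply: subsetP; rewrite identitiesS //; case: (cHc i).
apply: eq_bigr => f fH.
have [i iE] := (HcP _).1 (connected_component_reachable sH fH).
rewrite (big_pred1 i) // => j; apply/idP/eqP => [fj | ->].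
  by apply: Hc_inj; rewrite -iE; apply: connected_componentE.
by rewrite -iE reachable_identities.
Qed.

End GroupoidTheory.

Theorem theorem4p4 (T : finType) (G : finGroupoid T)
    (G_connected : gconnected G [set: T])
    (H : {set T}) (H_sub : subgroupoid G H)
    (n : nat) (Hc : 'I_n -> {set T}) (Hc_inj : injective Hc)
    (Hc_components : forall C : {set T},
       connected_component G H C <-> exists i : 'I_n, C = Hc i)
    (eH : 'I_n -> T) (eH_id : forall i : 'I_n, eH i \in identities G (Hc i))
    (e : T) (e_id : e \in identities G [set: T]) :
  (groupoid_index G H)%:R =
  #|identities G H|%:R *
    (\sum_(i < n) isotropy_index G [set: T] e (Hc i) (eH i)) :> rat.
Proof.
rewrite (groupoid_index_connected G_connected H_sub e_id).
rewrite (sum_identities_components _ H_sub Hc_inj Hc_components).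
congr (_ * _); apply: eq_bigr => i _.
have cHc : connected_component G H (Hc i) by apply/Hc_components; exists i.
have card_nz : #|identities G (Hc i)|%:R != 0 :> rat.
  by rewrite pnatr_eq0 -lt0n card_gt0; apply/set0Pn; exists (eH i).
under eq_bigr => f fC.
  rewrite (card_star_component H_sub cHc fC (eH_id i)) natrM invfM mulrCA.
  over.
by rewrite sumr_const -[LHS]mulr_natl mulVKf.
Qed.
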